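(* Let $K\subseteq\mathbb{C}$ be a number field and let $C(K):=\{2\cos(r\pi)\mid r\in\mathbb{Q}\}\cap K$. Define $f:K\rightarrow K$ by $f(x)=x^2-2$. Then $$C(K)=\mathrm{PrePer}(f,K),$$ where $\mathrm{PrePer}(f,K)$ denotes the set of preperiodic points of $f$ in $K$.
   Context: A number field is a finite field extension of $\mathbb{Q}$, here regarded as a subfield of $\mathbb{C}$ so that the intersection with a set of real numbers makes sense. $\mathbb{N}$ denotes the positive integers. For a map $g$ from a set $S$ to itself, $g^{(k)}$ denotes the $k$-fold composition of $g$ with itself. A point $P\in S$ is periodic with respect to $g$ if $g^{(n)}(P)=P$ for some $n\in\mathbb{N}$. A point $P\in S$ is preperiodic if $g^{(m)}(P)$ is periodic for some $m\in\mathbb{N}$; equivalently, the forward orbit $\{g^{(k)}(P)\mid k\ge 0\}$ is finite (with $g^{(0)}$ the identity). The set of preperiodic points of $g$ in $S$ is denoted by $\mathrm{PrePer}(g,S)$. *)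

(* Defs.v *)
From HB Require Import structures.
From mathcomp Require Import all_boot all_order all_algebra all_field.
From mathcomp Require Import complex.
From mathcomp Require Import all_classical all_reals all_analysis.

Set Implicit Arguments.
Unset Strict Implicit.
Unset Printing Implicit Defensive.

Import Order.TTheory GRing.Theory Num.Theory.

Local Open Scope classical_set_scope.
Local Open Scope ring_scope.
Local Open Scope complex_scope.

(* K is a subfield of C that is finite over Q: every such subfield is the image
   of an abstract finite extension of Q under a field embedding. *)
Definition number_field (R : realType) (K : set R[i]) : Prop :=
  exists (L : fieldExtType rat) (iota : {rmorphism L -> R[i]}), K = range iota.

Definition periodic (T : Type) (g : T -> T) (P : T) : Prop :=
  exists2 n : nat, (0 < n)%N & iter n g P = P.

(* A self-map of S is represented by a total map on the ambient type T that
   sends S into S. *)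
Definition PrePer (T : Type) (g : T -> T) (S : set T) : set T :=
  [set P | S P /\ exists2 m : nat, (0 < m)%N & periodic g (iter m g P)].

Definition CK (R : realType) (K : set R[i]) : set R[i] :=
  [set x | exists r : rat, x = (2 * cos (ratr r * pi))%:C] `&` K.

Definition f (R : realType) (x : R[i]) : R[i] := x ^+ 2 - 2.

Lemma f_stable (R : realType) (K : set R[i]) :
  number_field K -> set_fun K K (@f R).
Proof.
move=> [L [iota ->]] _ [y _ <-]; exists (y ^+ 2 - 2) => //.
by rewrite rmorphB rmorphXn rmorph_nat.
Qed.

(* Main.v *)
(** Since f (z + 1/z) = z^2 + 1/z^2, and every complex number has the form
    z + 1/z, the k-th iterate of f is z + 1/z |-> z^(2^k) + z^-(2^k); on
    2 cos t this is doubling of the angle.  If r has denominator q, then the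
    powers of 2 are eventually periodic modulo q, so 2 cos (r pi) is
    preperiodic.  Conversely, if two iterates of z + 1/z agree then z is a root
    of unity, so |z| = 1 and z + 1/z = 2 cos t for a real t; equality of the
    cosines of two distinct multiples of t forces t to be in Q pi. *)

Require Import Defs.
From HB Require Import structures.
From mathcomp Require Import all_boot all_order all_algebra all_field.
From mathcomp Require Import complex.
From mathcomp Require Import all_classical all_reals all_analysis.
From mathcomp Require Import ring lra zify cyclic.

Set Implicit Arguments.
Unset Strict Implicit.
Unset Printing Implicit Defensive.

Import Order.TTheory GRing.Theory Num.Theory.

Local Open Scope classical_set_scope.
Local Open Scope ring_scope.
Local Open Scope complex_scope.

Lemma iter_f_addV (R : realType) (z : R[i]) (n : nat) : z != 0 ->
  iter n (@f R) (z + z^-1) = z ^+ (2 ^ n) + z ^- (2 ^ n).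
Proof.
move=> z0; elim: n => [|n IHn]; first by rewrite expn0 !expr1.
rewrite iterS IHn /f expnSr !exprM.
have : z ^+ (2 ^ n) != 0 by rewrite expf_neq0.
by generalize (z ^+ (2 ^ n)) => w w0; field.
Qed.

Lemma iter_f_cos (R : realType) (t : R) (n : nat) :
  iter n (@f R) (2 * cos t)%:C = (2 * cos (t *+ 2 ^ n))%:C.
Proof.
elim: n => [|n IHn]; first by rewrite expn0 mulr1n.
rewrite iterS IHn /f expnSr mulrnA cos_mulr2n.
have -> : (2 : R[i]) = (2 : R)%:C by rewrite rmorph_nat.
by rewrite -rmorphXn -rmorphB; congr (_%:C); ring.
Qed.

(** The quadratic formula for $z^2 - xz + 1 = 0$: the two roots $x/2 \pm s$ have product 1, so each
    is nonzero and inverse to the other. *)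
Lemma exists_addV (R : realType) (x : R[i]) :
  exists2 z : R[i], z != 0 & x = z + z^-1.
Proof.
pose s := sqrtc ((x / 2) ^+ 2 - 1); pose z := x / 2 + s.
have zz' : z * (x / 2 - s) = 1.
  by rewrite mulrC -subr_sqr sqr_sqrtc opprB addrC subrK.
have z0 : z != 0.
  by apply/eqP => z0; move/eqP: zz'; rewrite z0 mul0r eq_sym oner_eq0.
exists z => //; rewrite -[z^-1]mulr1 -zz' mulKf // /z.
by field.
Qed.

(** The difference of the two sides, times $z^{a+b}$, factors as $(z^b - z^a)(z^{a+b} - 1)$. Hence
    $z^{b-a} = 1$ or $z^{a+b} = 1$, both with positive exponent. *)
Lemma addV_expr_norm1 (F : numFieldType) (z : F) (a b : nat) : (a < b)%N ->
  z != 0 -> z ^+ b + z ^- b = z ^+ a + z ^- a -> `|z| = 1.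
Proof.
move=> ab z0 e.
have za : z ^+ a != 0 by rewrite expf_neq0.
have zb : z ^+ b != 0 by rewrite expf_neq0.
have : (z ^+ b - z ^+ a) * (z ^+ b * z ^+ a - 1) = 0.
  transitivity ((z ^+ b + z ^- b - (z ^+ a + z ^- a)) * (z ^+ b * z ^+ a)).
    by field; rewrite za.
  by rewrite e subrr mul0r.
move/eqP; rewrite mulf_eq0 !subr_eq0 -exprD => /orP[] /eqP h.
- apply/eqP; rewrite -(@pexpr_eq1 _ _ (b - a)) ?subn_gt0 //.
  by rewrite -normrX expfB // h divff // normr1.
- apply/eqP; rewrite -(@pexpr_eq1 _ _ (b + a)) ?normr_ge0 //.
    by rewrite -normrX h normr1.
  by rewrite addn_gt0 (leq_ltn_trans _ ab).
Qed.

(** On the unit circle the inverse is the conjugate, so the sum is twice the real part, which lies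
    in $[-1, 1]$. *)
Lemma addV_norm1_cos (R : realType) (z : R[i]) : `|z| = 1 ->
  exists t : R, z + z^-1 = (2 * cos t)%:C.
Proof.
move=> z1; exists (acos (complex.Re z)).
rewrite invc_norm z1 expr1n invr1 mul1r addcJ acosK ?rmorphM ?rmorph_nat //.
rewrite in_itv /= -ler_norml.
by have := normc_ge_Re z; rewrite z1 -lecR.
Qed.

Lemma sin_eq0 (R : realType) (x : R) :
  sin x = 0 -> exists k : int, x = k%:~R * pi.
Proof.
have nonneg (y : R) : 0 <= y -> sin y = 0 -> exists k : nat, y = k%:R * pi.
  (* Removing [k] half-turns changes the sine at most by sign and leaves a remainder in $[0, \pi)$,
     where the sine vanishes only at 0. *)
  move=> y0 siny; pose k := Num.truncn (y / pi); exists k.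
  have pi0 := @pi_gt0 R.
  have /andP[ky yk] : k%:R <= y / pi < k.+1%:R.
    by apply: truncn_itv; rewrite divr_ge0 // ltW.
  rewrite ler_pdivlMr // in ky; rewrite ltr_pdivrMr // in yk.
  have : sin (y - k%:R * pi) = 0.
    have := alternatingn (@sinDpi R) k (y - k%:R * pi).
    rewrite -[pi *+ k]mulr_natl subrK siny => /esym/eqP.
    by rewrite mulf_eq0 signr_eq0 => /eqP.
  move: ky; rewrite -subr_ge0 le_eqVlt => /orP[/eqP/esym/subr0_eq //|ky] s0.
  have : 0 < sin (y - k%:R * pi).
    by rewrite sin_gt0_pi // ky /= ltrBlDr -[X in X + _]mul1r -mulrDl -mulrS.
  by rewrite s0 ltxx.
move=> sinx; have [x0|/ltW x0] := leP 0 x.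
  by have [k ->] := nonneg x x0 sinx; exists k%:Z.
have [||k xk] := nonneg (- x); rewrite ?oppr_ge0 ?sinN ?sinx ?oppr0 //.
by exists (- k%:Z); rewrite mulrNz mulNr -xk opprK.
Qed.

(** From $\cos a - \cos b = -2 \sin u \sin v$, with [u] the half sum and [v] the half difference. *)
Lemma cos_eq (R : realType) (a b : R) : cos a = cos b ->
  exists k : int, a - b = k%:~R * (pi *+ 2) \/ a + b = k%:~R * (pi *+ 2).
Proof.
move=> eqab; pose u := (a + b) / 2; pose v := (a - b) / 2.
have : sin u * sin v = 0.
  have ea : a = u + v by rewrite /u /v; field.
  have eb : b = u - v by rewrite /u /v; field.
  by move: eqab; rewrite ea eb cosD cosB => h; lra.
move/eqP; rewrite mulf_eq0 => /orP[] /eqP/sin_eq0[k ek]; exists k.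
- by right; rewrite mulrnAr -ek /u; field.
- by left; rewrite mulrnAr -ek /v; field.
Qed.

Lemma expn2_eventually_periodic (d : nat) : (0 < d)%N ->
  exists m n, [/\ (0 < m)%N, (0 < n)%N & (d %| 2 ^ m * (2 ^ n - 1))%N].
Proof.
(* The 2-part of [d] divides the power of 2, and its odd part [o] divides $2^{\varphi(o)} - 1$ by
   Euler. The successor keeps the first exponent positive when [d] is odd. *)
move=> d0; pose o := (d`_2^')%N; exists (logn 2 d).+1, (totient o).
have o0 : (0 < o)%N by exact: part_gt0.
split; rewrite ?totient_gt0 //.
rewrite -[X in (X %| _)%N](partnC 2%N d0) p_part.
apply: dvdn_mul; first by rewrite dvdn_exp2l.
rewrite -eqn_mod_dvd ?expn_gt0 //; apply/eqP/Euler_exp_totient.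
exact: pnat_coprime (pnat_id _) (part_pnat _ _).
Qed.

Lemma cosDn2pi (R : realType) (t : R) (k : int) :
  cos (t + k%:~R * (pi *+ 2)) = cos t.
Proof.
have nat_case (u : R) (n : nat) : cos (u + n%:R * (pi *+ 2)) = cos u.
  by rewrite mulr_natl (periodicn (@cosD2pi R)).
case: k => n; first exact: nat_case.
by rewrite NegzE mulrNz mulNr -[in RHS](subrK (n.+1%:R * (pi *+ 2)) t) nat_case.
Qed.

Lemma cos_rat_periodic (R : realType) (r : rat) :
  exists m n, [/\ (0 < m)%N, (0 < n)%N &
    cos ((ratr r * pi : R) *+ 2 ^ (n + m)) = cos ((ratr r * pi) *+ 2 ^ m)].
Proof.
have q0 : (0 < `|denq r|)%N by rewrite absz_gt0 denq_neq0.
have [m [n [m0 n0 /dvdnP[c ec]]]] := expn2_eventually_periodic q0.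
(* Multiplying [t] by the denominator gives only a multiple of $\pi$; the extra doubling makes it a
   multiple of $2\pi$. *)
exists m.+1, n; split=> //; set t := ratr r * pi.
have qt : t *+ `|denq r|%N = (numq r)%:~R * pi.
  rewrite -mulr_natl -[_%:R]/((`|denq r|%N)%:~R) absz_denq /t /ratr.
  have : (denq r)%:~R != 0 :> R by rewrite intr_eq0 denq_neq0.
  by move=> d0; rewrite mulrA mulrCA divff // mulr1.
suff -> : t *+ 2 ^ (n + m.+1) =
    t *+ 2 ^ m.+1 + (c%:Z * numq r)%:~R * (pi *+ 2) by rewrite cosDn2pi.
have -> : (2 ^ (n + m.+1) = 2 ^ m.+1 + `|denq r| * (c * 2))%N.
  rewrite mulnA [(_ * c)%N]mulnC -ec expnD expnS.
  have : (0 < 2 ^ n)%N by rewrite expn_gt0.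
  (* Writing $2^n$ as a successor removes the truncated subtraction. *)
  by case: (2 ^ n)%N => // l _; rewrite subn1; nia.
rewrite mulrnDr [t *+ (_ * _)]mulrnA qt; congr (_ + _).
by rewrite -mulr_natl natrM rmorphM /= -[pi *+ 2]mulr_natl -pmulrn; ring.
Qed.

(** One of $(b-a)t$ and $(a+b)t$ is an integer multiple of $2\pi$, and both multipliers are
    positive. *)
Lemma cos_eq_rat (R : realType) (t : R) (a b : nat) : (a < b)%N ->
  cos (t *+ b) = cos (t *+ a) -> exists r : rat, t = ratr r * pi.
Proof.
move=> ab /cos_eq[k].
have rat_of (c : nat) : (0 < c)%N -> t *+ c = k%:~R * (pi *+ 2) ->
    exists r : rat, t = ratr r * pi.
  move=> c0 e; exists (k%:~R * 2 / c%:R).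
  have c0' : c%:R != 0 :> R by rewrite pnatr_eq0 -lt0n.
  apply: (mulfI c0'); rewrite mulr_natl e.
  rewrite fmorph_div rmorphM /= ratr_int !ratr_nat.
  by field.
rewrite -mulrnBr ?(ltnW ab) // -mulrnDr => -[]; apply: rat_of.
  by rewrite subn_gt0.
by rewrite addn_gt0 (leq_ltn_trans _ ab).
Qed.

Theorem theorem5 (R : realType) (K : set R[i]) (hK : number_field K) :
  CK K = PrePer (@f R) K.
Proof.
apply/seteqP; split => [x [[r ->] Kx]|x [Kx [m m0 [n n0]]]].
  have [m [n [m0 n0 e]]] := cos_rat_periodic R r.
  split=> //; exists m => //; exists n => //.
  by rewrite -iterD !iter_f_cos e.
have [z z0 xz] := exists_addV x.
(* The period [n] is positive, so the two iterates give distinct exponents of [z], and later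
   distinct multiples of [t]. *)
have ltmn : (2 ^ m < 2 ^ (n + m))%N.
  by rewrite ltn_exp2l // -[ltnLHS]add0n ltn_add2r.
rewrite -iterD => e; have z1 : `|z| = 1.
  by apply: (addV_expr_norm1 ltmn z0); rewrite -!iter_f_addV // -xz.
have [t] := addV_norm1_cos z1; rewrite -xz => et.
move: Kx e; rewrite et !iter_f_cos => Kx /complexI/mulfI h.
have [|r er] := cos_eq_rat ltmn (h _); first by rewrite pnatr_eq0.
by split=> //; exists r; rewrite er.
Qed.
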